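(* Let $f_i(x)=\tfrac12 x^TA_ix+b_i^Tx$ for $i=1,\dots,n$, with $A_i\in\mathbb{R}^{d\times d}$ symmetric positive semidefinite and $b_i\in\mathbb{R}^d$. Suppose each $f_i$ is $L$-smooth and $F=\frac1n\sum_{i=1}^n f_i$ is $\mu$-strongly convex with $\mu>0$ and unique minimizer $x^*$. Put $\kappa=L/\mu$. Let $T\ge 2$ be a multiple of $n$ with $$\frac{T}{\log T}>6(1+\kappa)n ,$$ and run RandomShuffle on $F$ for $T$ iterations with constant step size $\gamma=\frac{4\log T}{T\mu}$. Assume the boundedness assumptions with constants $D,G$ stated in the context. Then the final iterate $x_T$ satisfies $$\mathbb{E}\big[\|x_T-x^*\|^2\big]\le \mathcal{O}\Big(\frac{1}{T^2}+\frac{n^3}{T^3}\Big).$$ That is, there are constants $C_0,q>0$ depending only on $\mu,L,D,G$ such that the left side is at most $C_0(1+\log T)^q\big(\frac1{T^2}+\frac{n^3}{T^3}\big)$.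
   Context: Norms are Euclidean for vectors and spectral for matrices. $f$ is $L$-smooth if $\|\nabla f(x)-\nabla f(y)\|\le L\|x-y\|$ for all $x,y$. $F$ is $\mu$-strongly convex if $F(x)\ge F(y)+\langle\nabla F(y),x-y\rangle+\frac{\mu}{2}\|x-y\|^2$ for all $x,y$. RandomShuffle with step size $\gamma$, run for $T=ln$ iterations ($l$ a positive integer, the number of epochs) from $x_0\in\mathbb{R}^d$: set $x^1_0=x_0$. In each epoch $t=1,\dots,l$ draw a permutation $\sigma_t$ of $\{1,\dots,n\}$ uniformly at random, independently across epochs, and for $k=1,\dots,n$ set $x^t_k=x^t_{k-1}-\gamma\nabla f_{\sigma_t(k)}(x^t_{k-1})$; then put $x^{t+1}_0=x^t_n$. The output is $x_T=x^l_n$. Expectation is over the permutations. Boundedness assumptions: there are constants $D,G>0$ such that, for every realization of the permutations, every iterate $x$ satisfies $\|x-x^*\|\le D$; and $\|\nabla f_i(x)\|\le G$ for all $i$ and all $x$ with $\|x-x^*\|\le D$. Convention: $\mathcal{O}(\cdot)$ hides logarithmic factors and constants depending only on the problem constants, not on $n$ or $T$. *)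

(* Defs.v *)
From HB Require Import structures.
From mathcomp Require Import all_boot all_order all_algebra all_fingroup.
From mathcomp Require Import all_classical all_reals all_analysis.
Set Implicit Arguments.
Unset Strict Implicit.
Unset Printing Implicit Defensive.
Import Order.TTheory GRing.Theory Num.Theory.
Import numFieldNormedType.Exports.
Local Open Scope ring_scope.

Section Euclidean.
Context {R : realType} {d : nat}.
Implicit Types (u v x y : 'cV[R]_d) (f : 'cV[R]_d -> R).

Definition dotv u v : R := \sum_(i < d) u i 0 * v i 0.

(* The norm `|u| of the library on matrices is the sup norm; it defines the
   same topology, hence the same derivatives. *)
Definition enorm u : R := Num.sqrt (dotv u u).

Definition gradient f x : 'cV[R]_d := \col_j 'D_(delta_mx j 0) f x.

Definition L_smooth (L : R) f : Prop :=
  (forall x, differentiable f x) /\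
  (forall x y, enorm (gradient f x - gradient f y) <= L * enorm (x - y)).

Definition strongly_convex (mu : R) f : Prop :=
  (forall x, differentiable f x) /\
  (forall x y,
     f y + dotv (gradient f y) (x - y) + mu / 2 * enorm (x - y) ^+ 2 <= f x).

Definition is_unique_minimizer f x : Prop :=
  (forall y, f x <= f y) /\ (forall z, (forall y, f z <= f y) -> z = x).

Definition psd (A : 'M[R]_d) : Prop := forall x, 0 <= dotv x (A *m x).

Definition quadratic (A : 'M[R]_d) (b : 'cV[R]_d) x : R :=
  2^-1 * dotv x (A *m x) + dotv b x.

Definition average n (f : 'I_n -> 'cV[R]_d -> R) x : R :=
  n%:R^-1 * \sum_(i < n) f i x.

End Euclidean.

Section RandomShuffle.
Context {R : realType} {d n : nat}.
Variables (f : 'I_n -> 'cV[R]_d -> R) (gamma : R).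

(* The k-th iterate (0 <= k <= n) of an epoch with permutation [sigma] started
   at x; k = 0 gives x. *)
Definition epoch (sigma : 'S_n) (x : 'cV[R]_d) (k : nat) : 'cV[R]_d :=
  foldl (fun y i => y - gamma *: gradient (f (sigma i)) y) x
        (take k (enum 'I_n)).

(* The point reached after t full epochs (0 <= t <= l). *)
Definition after_epochs l (s : {ffun 'I_l -> 'S_n}) (x0 : 'cV[R]_d) (t : nat) :
    'cV[R]_d :=
  foldl (fun x j => epoch (s j) x n) x0 (take t (enum 'I_l)).

(* Epochs are numbered from 0: this is x^(t+1)_k. *)
Definition iterate l (s : {ffun 'I_l -> 'S_n}) (x0 : 'cV[R]_d) (t : 'I_l)
    (k : nat) : 'cV[R]_d :=
  epoch (s t) (after_epochs s x0 t) k.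

Definition output l (s : {ffun 'I_l -> 'S_n}) (x0 : 'cV[R]_d) : 'cV[R]_d :=
  after_epochs s x0 l.

End RandomShuffle.

(* Expectation under the uniform law on a finite type. On {ffun 'I_l -> 'S_n}
   this is the law of l independent uniform permutations. *)
Definition unif_expectation {R : realType} (Omega : finType) (X : Omega -> R) : R :=
  (\sum_(w : Omega) X w) / #|Omega|%:R.

(* Main.v *)
Require Import Defs.
From HB Require Import structures.
From mathcomp Require Import all_boot all_order all_algebra all_fingroup.
From mathcomp Require Import all_classical all_reals all_analysis.
From mathcomp Require Import ring lra zify.
Import Order.TTheory GRing.Theory Num.Theory.
Import numFieldNormedType.Exports.
Local Open Scope ring_scope.

(** Why the theorem holds.

    Write h = gamma * n for the total step of an epoch, x for its starting
    point, v = x - xstar, and g_i for the gradient of f_i at x. All gradients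
    met along the way have norm at most G, so the iterates of the epoch stay
    within h * G of x; expanding the gradients around x gives
      y = x - gamma * (sum_i g_i) + gamma^2 * S_sigma + O(h^3),
      S_sigma = sum over j < k of A_(sigma k) g_(sigma j),
    where y is the end of the epoch (epoch_expansion). Without the term in
    gamma^2 this is a gradient step of length h on F, which contracts
    distances to xstar. The term in gamma^2 has size h^2 for a given sigma, and
    this alone would only give an error of order h in the distance to xstar.
    Its mean is better. Reversing sigma exchanges the pairs j < k with the pairs
    j > k, hence S_sigma + S_(reversed sigma) is a sum over all pairs j <> k,
    namely
      (sum_i A_i) (sum_i g_i) - sum_i A_i g_i
    (second_order_reversal). Since the g_i sum up to (sum_i A_i) v, the first
    part is O(n^2 |v|), absorbed by the contraction when h is small, and the
    second is only O(n).

    Averaging the squared distance over sigma and its reversal then yields, for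
    every sigma,
      mean of |y - xstar|^2
        <= (1 - h mu / 2) |v|^2 + h * O(gamma^2 + h^4 + h^3)
    (epoch_pair_contraction). Reversing the permutation of one epoch is a
    bijection of the sample space that does not affect the preceding epochs, so
    the same recursion holds for the expectations (unif_expectation_paired). Its
    solution is (1 - h mu / 2)^l D^2 + O(gamma^2 + h^3), and the choice of gamma
    makes the first summand at most D^2 / T^2, gamma^2 = O(log^2 T / T^2) and
    h^3 = O(log^3 T n^3 / T^3).

    All this needs h <= eps for a threshold eps depending on mu and L.
    When h > eps, the ratio n^3 / T^3 exceeds a constant times
    (log T)^(-3), and the bound D^2 on the squared distance suffices. *)

(** * Euclidean dot product and norm *)

Section EuclideanNorm.
Context {R : realType} {d : nat}.
Implicit Types (u v w : 'cV[R]_d) (a : R).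

Lemma dotvC u v : dotv u v = dotv v u.
Proof. by apply: eq_bigr => i _; rewrite mulrC. Qed.

Lemma dotvDr u v w : dotv u (v + w) = dotv u v + dotv u w.
Proof.
by rewrite /dotv -big_split; apply: eq_bigr => i _; rewrite mxE mulrDr.
Qed.

Lemma dotvZr a u v : dotv u (a *: v) = a * dotv u v.
Proof.
by rewrite /dotv mulr_sumr; apply: eq_bigr => i _; rewrite mxE mulrCA.
Qed.

Lemma dotvDl u v w : dotv (u + v) w = dotv u w + dotv v w.
Proof. by rewrite dotvC dotvDr !(dotvC w). Qed.

Lemma dotvZl a u v : dotv (a *: u) v = a * dotv u v.
Proof. by rewrite dotvC dotvZr dotvC. Qed.

Lemma dotvNr u v : dotv u (- v) = - dotv u v.
Proof. by rewrite -scaleN1r dotvZr mulN1r. Qed.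

Lemma dotvNl u v : dotv (- u) v = - dotv u v.
Proof. by rewrite dotvC dotvNr dotvC. Qed.

Lemma dotv0l u : dotv 0 u = 0.
Proof. by rewrite -(scale0r 0) dotvZl mul0r. Qed.

Definition dotvE := (dotvDl, dotvDr, dotvZl, dotvZr, dotvNl, dotvNr).

Lemma dotvv_ge0 u : 0 <= dotv u u.
Proof. by apply: sumr_ge0 => i _; rewrite -expr2 sqr_ge0. Qed.

Lemma sqr_enorm u : enorm u ^+ 2 = dotv u u.
Proof. by rewrite sqr_sqrtr ?dotvv_ge0. Qed.

Lemma enorm_ge0 u : 0 <= enorm u.
Proof. exact: sqrtr_ge0. Qed.

Lemma dotvv_eq0 u : dotv u u = 0 -> u = 0.
Proof.
move=> /eqP; rewrite psumr_eq0; last by move=> i _; rewrite -expr2 sqr_ge0.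
move=> /allP u0; apply/matrixP => i j; rewrite ord1 mxE.
by have := u0 i (mem_index_enum i); rewrite mulf_eq0 orbb => /eqP.
Qed.

Lemma enorm0 : enorm (0 : 'cV[R]_d) = 0.
Proof. by rewrite /enorm dotv0l sqrtr0. Qed.

Lemma cauchy_schwarz u v : dotv u v <= enorm u * enorm v.
Proof.
have [->|v0] := eqVneq v 0; first by rewrite enorm0 dotvC dotv0l mulr0.
have vv : 0 < dotv v v.
  rewrite lt_neqAle dotvv_ge0 andbT eq_sym.
  by apply: contra v0 => /eqP /dotvv_eq0 ->.
(* the Gram determinant, up to the factor dotv v v, is the square of the part
   of u orthogonal to v *)
have := dotvv_ge0 (dotv v v *: u - dotv u v *: v).
rewrite !dotvE (dotvC v u) => gram.
have {}gram : 0 <= dotv v v * (dotv u u * dotv v v - dotv u v ^+ 2) by lra.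
rewrite pmulr_rge0 // subr_ge0 in gram.
rewrite /enorm -sqrtrM ?dotvv_ge0 //.
by rewrite (le_trans (ler_norm _)) // -sqrtr_sqr ler_wsqrtr.
Qed.

Lemma enormD u v : enorm (u + v) <= enorm u + enorm v.
Proof.
rewrite -(@ler_pXn2r _ 2) ?nnegrE ?addr_ge0 ?enorm_ge0 //.
rewrite sqrrD !sqr_enorm !dotvE (dotvC v u).
by have := cauchy_schwarz u v; lra.
Qed.

Lemma enormZ a u : enorm (a *: u) = `|a| * enorm u.
Proof. by rewrite /enorm !dotvE mulrA -expr2 sqrtrM ?sqr_ge0 // sqrtr_sqr. Qed.

Lemma enormN u : enorm (- u) = enorm u.
Proof. by rewrite -scaleN1r enormZ normrN1 mul1r. Qed.

Lemma enorm_sum_le n (P : pred 'I_n) (x : 'I_n -> 'cV[R]_d) a : 0 <= a ->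
  (forall i, enorm (x i) <= a) -> enorm (\sum_(i | P i) x i) <= n%:R * a.
Proof.
move=> a0 xa; apply: (@le_trans _ _ (\sum_(i | P i) a)).
  elim/big_ind2: _ => [|y b z c yb zc|i _]; rewrite ?enorm0 ?xa //.
  by rewrite (le_trans (enormD _ _)) ?lerD.
rewrite big_const iter_addr_0 -[a *+ _]mulr_natl ler_wpM2r // ler_nat.
by rewrite -[leqRHS]card_ord max_card.
Qed.

Lemma sqr_enorm_le u a : enorm u <= a -> enorm u ^+ 2 <= a ^+ 2.
Proof.
move=> ua; rewrite ler_pXn2r ?nnegrE ?enorm_ge0 //.
exact: le_trans (enorm_ge0 _) ua.
Qed.

End EuclideanNorm.

(** * Quadratic functions *)

Section Quadratic.
Context {R : realType} {d : nat}.
Implicit Types (A : 'M[R]_d) (b x v : 'cV[R]_d).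

Lemma dotv_mulmx_sym A x v : A^T = A -> dotv x (A *m v) = dotv v (A *m x).
Proof.
have dotE u w : dotv u w = (u^T *m w) 0 0.
  by rewrite mxE; apply: eq_bigr => i _; rewrite mxE.
by move=> As; rewrite dotvC !dotE trmx_mul As mulmxA.
Qed.

Lemma quadratic_expansion A b x v (t : R) : A^T = A ->
  quadratic A b (x + t *: v) =
  quadratic A b x + t * dotv (A *m x + b) v + 2^-1 * t ^+ 2 * dotv v (A *m v).
Proof.
move=> As; rewrite /quadratic mulmxDr -scalemxAr !dotvE.
rewrite (dotv_mulmx_sym A x v As) (dotvC (A *m x)).
by field.
Qed.

Lemma gradient_quadratic A b x : A^T = A ->
  gradient (quadratic A b) x = A *m x + b.
Proof.
move=> As; apply/matrixP => j k; rewrite ord1 mxE {k}.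
set e := delta_mx j 0.
have -> : (A *m x + b) j 0 = dotv (A *m x + b) e.
  rewrite /dotv (bigD1 j) //= big1 => [|i ij]; rewrite /e !mxE ?eqxx ?mulr1 ?addr0 //.
  by rewrite (negbTE ij) mulr0.
set c := dotv _ e; pose q := 2^-1 * dotv e (A *m e).
apply: cvg_lim => //.
have lim : ((c + t * q) @[t --> (0 : R)^'] --> c)%classic.
  apply: cvg_within_filter.
  have {2}-> : c = c + 0 * q by rewrite mul0r addr0.
  by apply: cvgD; [exact: cvg_cst | apply: cvgM; [exact: cvg_id | exact: cvg_cst]].
apply: cvg_trans lim; apply: near_eq_cvg; near=> t.
have t0 : t != 0 by near: t; exact: nbhs_dnbhs_neq.
rewrite /= [t *: e + x]addrC quadratic_expansion // /q /c /GRing.scale /=.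
by field.
Unshelve. all: by end_near. Qed.

End Quadratic.

Section QuadraticHypotheses.
Context {R : realType} {d : nat}.
Implicit Types (A : 'M[R]_d) (b x : 'cV[R]_d).

Lemma L_smooth_mulmx_le L A b x : A^T = A -> L_smooth L (quadratic A b) ->
  enorm (A *m x) <= L * enorm x.
Proof.
move=> As [_ /(_ x 0)].
by rewrite !gradient_quadratic // mulmx0 add0r addrK subr0.
Qed.

(** In the convexity inequality between x and the origin the linear terms
    <b, x> cancel, which leaves the quadratic form of A. *)
Lemma strongly_convex_quadratic mu A b x : A^T = A ->
  strongly_convex mu (quadratic A b) -> mu * dotv x x <= dotv x (A *m x).
Proof.
move=> As [_ /(_ x 0)].
rewrite gradient_quadratic // mulmx0 add0r subr0 sqr_enorm /quadratic.
rewrite !dotv0l (dotvC b 0) dotv0l => cvx.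
by move: (dotv x x) (dotv x (A *m x)) (dotv b x) cvx => xx xAx bx cvx; lra.
Qed.

Lemma average_quadratic n (A : 'I_n -> 'M[R]_d) (b : 'I_n -> 'cV[R]_d) :
  average (fun i => quadratic (A i) (b i)) =
  quadratic (n%:R^-1 *: \sum_i A i) (n%:R^-1 *: \sum_i b i).
Proof.
apply/funext => x.
have dotv_sum (u : 'I_n -> 'cV[R]_d) : dotv x (\sum_i u i) = \sum_i dotv x (u i).
  by apply: (big_morph (dotv x)) => [v w|]; rewrite ?dotvDr // dotvC dotv0l.
rewrite /average /quadratic -scalemxAl dotvZr dotvZl (dotvC (\sum_i b i)).
rewrite mulmx_suml !dotv_sum [in RHS]mulrCA -mulrDr; congr (_ * _).
rewrite mulr_sumr -big_split; apply: eq_bigr => i _ /=.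
by rewrite (dotvC x (b i)).
Qed.

(** Moving from the minimizer against the gradient g by a step t changes the
    value by - t |g|^2 + t^2 / 2 <g, A g>, which is negative for small t > 0
    unless g = 0. *)
Lemma minimizer_quadratic A b xstar : A^T = A -> psd A ->
  (forall y, quadratic A b xstar <= quadratic A b y) -> A *m xstar + b = 0.
Proof.
move=> As Apsd xmin; set g := A *m xstar + b.
set p := dotv g g; set q := dotv g (A *m g).
have q0 : 0 <= q by exact: Apsd.
have q1 : 0 < q + 1 by rewrite ltr_wpDl.
pose t := p / (q + 1).
have := xmin (xstar + (- t) *: g).
rewrite quadratic_expansion // -/g -/p -/q -addrA lerDl.
(* this step makes the change equal to - t^2 (q / 2 + 1) *)
have pE : p = t * (q + 1) by rewrite /t divfK ?gt_eqF.
rewrite [in X in X -> _]pE (_ : _ + _ = - (t ^+ 2 * (2^-1 * q + 1))); last by field.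
rewrite oppr_ge0 pmulr_lle0 ?ltr_wpDl ?mulr_ge0 ?invr_ge0 // => t2.
have t0 : t = 0 by apply/eqP; rewrite -sqrf_eq0 eq_le t2 sqr_ge0.
by apply: dotvv_eq0; rewrite -/p pE t0 mul0r.
Qed.

End QuadraticHypotheses.

(** * Reversing a permutation *)

(** Reversal turns the pairs j < k into the pairs j > k, so that the two sums
    together miss only the diagonal. *)
Lemma sum_reversal_pairs {V : zmodType} n (c : 'I_n -> 'I_n -> V) :
  \sum_(k < n) \sum_(j < n | (j < k)%N) c k j
  + \sum_(k < n) \sum_(j < n | (j < k)%N) c (rev_ord k) (rev_ord j)
  = \sum_(k < n) \sum_j c k j - \sum_k c k k.
Proof.
have -> : \sum_(k < n) \sum_(j < n | (j < k)%N) c (rev_ord k) (rev_ord j)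
    = \sum_(k < n) \sum_(j < n | (k < j)%N) c k j.
  rewrite [RHS](reindex_inj rev_ord_inj) /=; apply: eq_bigr => k _.
  rewrite [RHS](reindex_inj rev_ord_inj) /=; apply: eq_bigl => j.
  by have := ltn_ord j; have := ltn_ord k; lia.
rewrite -!sumrB -big_split /=; apply: eq_bigr => k _.
rewrite [X in _ = X - _](bigD1 k) //= [_ + _ - _]addrC addKr.
rewrite [RHS](bigID (fun j : 'I_n => (j < k)%N)) /=; congr (_ + _).
  by apply: eq_bigl => j; rewrite -val_eqE /=; lia.
by apply: eq_bigl => j; rewrite -val_eqE /=; lia.
Qed.

Definition reversal n : 'S_n := perm (@rev_ord_inj n).

Lemma sum_perm_reversal_pairs {V : zmodType} n (c : 'I_n -> 'I_n -> V)
    (sigma : 'S_n) :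
  \sum_(k < n) \sum_(j < n | (j < k)%N) c (sigma k) (sigma j)
  + \sum_(k < n) \sum_(j < n | (j < k)%N)
      c ((reversal n * sigma)%g k) ((reversal n * sigma)%g j)
  = \sum_(k < n) \sum_j c k j - \sum_k c k k.
Proof.
have -> : \sum_(k < n) \sum_(j < n | (j < k)%N)
      c ((reversal n * sigma)%g k) ((reversal n * sigma)%g j)
    = \sum_(k < n) \sum_(j < n | (j < k)%N)
      c (sigma (rev_ord k)) (sigma (rev_ord j)).
  by apply: eq_bigr => k _; apply: eq_bigr => j _; rewrite !permM !permE.
rewrite (sum_reversal_pairs n (fun k j => c (sigma k) (sigma j))).
congr (_ - _); last by rewrite [RHS](reindex_inj (@perm_inj _ sigma)).
rewrite [RHS](reindex_inj (@perm_inj _ sigma)); apply: eq_bigr => k _.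
by rewrite [RHS](reindex_inj (@perm_inj _ sigma)).
Qed.

(** * Expansion of one epoch *)

Section Epoch.
Context {R : realType} {d n : nat}.
Variables (f : 'I_n -> 'cV[R]_d -> R) (gamma : R).
Implicit Types (sigma : 'S_n) (x : 'cV[R]_d) (k : nat).

Lemma epoch0 sigma x : epoch f gamma sigma x 0 = x.
Proof. by rewrite /epoch take0. Qed.

Lemma epochS sigma x (i : 'I_n) :
  epoch f gamma sigma x i.+1 = epoch f gamma sigma x i
    - gamma *: gradient (f (sigma i)) (epoch f gamma sigma x i).
Proof.
rewrite /epoch (take_nth i) ?size_enum_ord // foldl_rcons.
by rewrite (_ : nth i _ i = i) // nth_ord_enum.
Qed.

Lemma epoch_sum sigma x k : (k <= n)%N ->
  epoch f gamma sigma x k = x - gamma *: \sum_(j < n | (j < k)%N)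
    gradient (f (sigma j)) (epoch f gamma sigma x j).
Proof.
elim: k => [|k IH] kn; first by rewrite epoch0 big_pred0 // scaler0 subr0.
rewrite (epochS sigma x (Ordinal kn)) /= {1}IH ?(ltnW kn) //.
rewrite [in RHS](bigD1 (Ordinal kn)) //= scalerDr opprD addrA addrAC.
congr (_ - _ *: _ - _); apply: eq_bigl => j.
by rewrite -val_eqE /=; lia.
Qed.

End Epoch.

(** The arithmetic behind epoch_pair_contraction. There a is the distance
    |v| to the minimizer at the start of the epoch, uu = |u|^2 for the point
    u + xstar reached by the full gradient step, w1 and w2 are the squared norms of the
    deviations W1, W2 of the two epochs from that point, and c1 = <u, W1>,
    c2 = <u, W2>. The terms linear in a are split by Young's inequality: each
    costs half of the slack h mu a^2. *)
Lemma pair_energy_bound {R : realFieldType} (h gamma mu K G a uu c1 c2 w1 w2 : R) :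
  0 < mu -> 0 <= h -> 4 * (h * K) ^+ 2 <= h * mu ->
  uu <= (1 - 2 * (h * mu) + (h * K) ^+ 2) * a ^+ 2 ->
  c1 + c2 <= a * ((h * K) ^+ 2 * a + gamma * h * K * G
                  + 2 * (h ^+ 3 * K ^+ 2 * G)) ->
  w1 <= (h ^+ 2 * K * G) ^+ 2 -> w2 <= (h ^+ 2 * K * G) ^+ 2 ->
  (uu + c1 + (c1 + w1) + (uu + c2 + (c2 + w2))) / 2
  <= (1 - h * mu / 2) * a ^+ 2
     + h * (gamma ^+ 2 * (K ^+ 2 * G ^+ 2 / (2 * mu))
            + h ^+ 4 * (2 * K ^+ 4 * G ^+ 2 / mu) + h ^+ 3 * (K ^+ 2 * G ^+ 2)).
Proof.
move=> mu0 h0 hK2 u_le cross w1_le w2_le.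
have young1 : a * (gamma * h * K * G)
    <= h * mu / 2 * a ^+ 2 + h * (gamma ^+ 2 * (K ^+ 2 * G ^+ 2 / (2 * mu))).
  rewrite -subr_ge0 (_ : _ - _ = h / (2 * mu) * (mu * a - gamma * K * G) ^+ 2).
    by rewrite mulr_ge0 ?divr_ge0 ?sqr_ge0 ?mulr_ge0 // ltW.
  by field; rewrite gt_eqF.
have young2 : a * (2 * (h ^+ 3 * K ^+ 2 * G))
    <= h * mu / 2 * a ^+ 2 + h * (h ^+ 4 * (2 * K ^+ 4 * G ^+ 2 / mu)).
  rewrite -subr_ge0
    (_ : _ - _ = h / (2 * mu) * (mu * a - 2 * h ^+ 2 * K ^+ 2 * G) ^+ 2).
    by rewrite mulr_ge0 ?divr_ge0 ?sqr_ge0 ?mulr_ge0 // ltW.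
  by field; rewrite gt_eqF.
have hKa : 4 * (h * K) ^+ 2 * a ^+ 2 <= h * mu * a ^+ 2.
  by rewrite ler_wpM2r ?sqr_ge0.
rewrite (_ : _ * a ^+ 2 = a ^+ 2 - 2 * (h * mu * a ^+ 2) + (h * K) ^+ 2 * a ^+ 2)
  in u_le; last by ring.
rewrite (_ : a * _ = (h * K) ^+ 2 * a ^+ 2 + a * (gamma * h * K * G)
  + a * (2 * (h ^+ 3 * K ^+ 2 * G))) in cross; last by ring.
rewrite (_ : (h ^+ 2 * K * G) ^+ 2 = h * (h ^+ 3 * (K ^+ 2 * G ^+ 2)))
  in w1_le w2_le; last by ring.
rewrite (_ : (1 - h * mu / 2) * a ^+ 2 = a ^+ 2 - 2^-1 * (h * mu * a ^+ 2));
  last by field.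
rewrite (_ : h * mu / 2 * a ^+ 2 = 2^-1 * (h * mu * a ^+ 2)) in young1 young2;
  last by field.
rewrite -mulrA in hKa.
rewrite !mulrDr.
(* the claim is now linear in the following products *)
move: (h * mu * a ^+ 2) ((h * K) ^+ 2 * a ^+ 2) hKa
  => P Q hKa in u_le cross young1 young2 *.
move: (a * (gamma * h * K * G)) (a * (2 * (h ^+ 3 * K ^+ 2 * G)))
  => Z1 Z2 in cross young1 young2.
move: (h * (gamma ^+ 2 * _)) (h * (h ^+ 4 * _)) (h * (h ^+ 3 * _))
  => Y1 Y2 Y3 in young1 young2 w1_le w2_le *.
move: (a ^+ 2) u_le => aa u_le.
clear - u_le cross w1_le w2_le young1 young2 hKa.
lra.
Qed.

Section EpochExpansion.
Context {R : realType} {d n : nat}.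
Variables (f : 'I_n -> 'cV[R]_d -> R) (A : 'I_n -> 'M[R]_d) (b : 'I_n -> 'cV[R]_d).
Variables (gamma K G : R).
Hypothesis gradE : forall i x, gradient (f i) x = A i *m x + b i.
Hypothesis A_le : forall i x, enorm (A i *m x) <= K * enorm x.
Hypotheses (gamma0 : 0 <= gamma) (K0 : 0 <= K) (G0 : 0 <= G).
Implicit Types (sigma : 'S_n) (x : 'cV[R]_d).

Local Notation h := (gamma * n%:R).

(** The second-order part of the displacement over the epoch, with all the
    gradients taken at its starting point. *)
Definition second_order sigma x : 'cV[R]_d := gamma ^+ 2 *: \sum_(k < n)
  \sum_(j < n | (j < k)%N) A (sigma k) *m gradient (f (sigma j)) x.

Let step sigma x (k : 'I_n) := epoch f gamma sigma x k.

(** W is the effect of evaluating the gradients at the moving iterates rather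
    than at x. It is gamma times a sum of n terms A_i (y - x) with |y - x| at
    most h * G; replacing y - x by its own first-order expansion produces
    second_order, with an error smaller by a further factor h * K. *)
Lemma epoch_expansion sigma x :
  (forall k : 'I_n, enorm (gradient (f (sigma k)) (epoch f gamma sigma x k)) <= G) ->
  exists W : 'cV[R]_d,
    [/\ epoch f gamma sigma x n = x - gamma *: \sum_i gradient (f i) x + W,
        enorm W <= h ^+ 2 * K * G &
        enorm (W - second_order sigma x) <= h ^+ 3 * K ^+ 2 * G].
Proof.
move=> gG.
have h0 : 0 <= h by rewrite mulr_ge0.
have drift (k : 'I_n) : enorm (step sigma x k - x) <= h * G.
  rewrite /step epoch_sum ?(ltnW (ltn_ord k)) // addrC addKr enormN enormZ.
  by rewrite ger0_norm // -mulrA ler_wpM2l // enorm_sum_le.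
have gradD i y : gradient (f i) y = gradient (f i) x + A i *m (y - x).
  by rewrite !gradE mulmxBr addrAC subrKC.
exists (- (gamma *: \sum_(k < n) A (sigma k) *m (step sigma x k - x))); split.
- rewrite epoch_sum // -addrA -opprD -scalerDr; congr (_ - _ *: _).
  rewrite [X in _ = X + _](reindex_inj (@perm_inj _ sigma)) -big_split /=.
  by apply: eq_big => [k|k _]; rewrite ?ltn_ord // [LHS]gradD.
- rewrite enormN enormZ ger0_norm //.
  rewrite (_ : h ^+ 2 * K * G = gamma * (n%:R * (K * (h * G)))); last by ring.
  rewrite ler_wpM2l // enorm_sum_le ?mulr_ge0 // => k.
  by rewrite (le_trans (A_le _ _)) ?ler_wpM2l.
- have -> : - (gamma *: \sum_(k < n) A (sigma k) *m (step sigma x k - x))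
      - second_order sigma x = gamma *: \sum_(k < n) A (sigma k) *m
        (gamma *: \sum_(j < n | (j < k)%N) A (sigma j) *m (step sigma x j - x)).
    rewrite /second_order expr2 -scalerA -opprD -scalerDr -scalerN; congr (_ *: _).
    rewrite scaler_sumr -big_split -sumrN; apply: eq_bigr => k _ /=.
    rewrite /step epoch_sum ?(ltnW (ltn_ord k)) // addrAC subrr add0r.
    rewrite -mulmx_sumr scalemxAr -mulmxDr -mulmxN; congr (_ *m _).
    rewrite addrC opprB -scalerBr -sumrB; congr (_ *: _).
    by apply: eq_bigr => j _; rewrite [X in X - _]gradD addrAC subrr add0r.
  rewrite enormZ ger0_norm //.
  rewrite (_ : h ^+ 3 * K ^+ 2 * G
     = gamma * (n%:R * (K * (gamma * (n%:R * (K * (h * G))))))); last by ring.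
  rewrite ler_wpM2l // enorm_sum_le ?mulr_ge0 // => k.
  rewrite (le_trans (A_le _ _)) // ler_wpM2l // enormZ ger0_norm //.
  rewrite ler_wpM2l // enorm_sum_le ?mulr_ge0 // => j.
  by rewrite (le_trans (A_le _ _)) ?ler_wpM2l.
Qed.

Lemma sum_mulmx_le x : enorm ((\sum_i A i) *m x) <= n%:R * K * enorm x.
Proof.
by rewrite mulmx_suml -mulrA enorm_sum_le ?mulr_ge0 ?enorm_ge0.
Qed.

Lemma second_order_reversal sigma x :
  second_order sigma x + second_order (reversal n * sigma)%g x
  = gamma ^+ 2 *: ((\sum_i A i) *m (\sum_i gradient (f i) x)
                   - \sum_i A i *m gradient (f i) x).
Proof.
rewrite -scalerDr (sum_perm_reversal_pairs n (fun k j => A k *m gradient (f j) x)).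
congr (_ *: (_ - _)).
by rewrite mulmx_suml; apply: eq_bigr => k _; rewrite mulmx_sumr.
Qed.

(** The contraction comes from the full gradient step u = v - gamma H v. The
    deviations W1 and W2 enter linearly only through their sum, in which the
    terms of order h^2 collapse by second_order_reversal; elsewhere the crude
    bound |W| = O(h^2) is enough, since it appears squared. *)
Lemma epoch_pair_contraction sigma x xstar mu : 0 < mu ->
  h <= mu / (4 * K ^+ 2) -> 0 < K ->
  (forall y, mu * n%:R * dotv y y <= dotv y ((\sum_i A i) *m y)) ->
  \sum_i gradient (f i) xstar = 0 ->
  (forall i, enorm (gradient (f i) x) <= G) ->
  (forall k : 'I_n, enorm (gradient (f (sigma k)) (epoch f gamma sigma x k)) <= G) ->
  (forall k : 'I_n, enorm (gradient (f ((reversal n * sigma)%g k))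
     (epoch f gamma (reversal n * sigma)%g x k)) <= G) ->
  (enorm (epoch f gamma sigma x n - xstar) ^+ 2
   + enorm (epoch f gamma (reversal n * sigma)%g x n - xstar) ^+ 2) / 2
  <= (1 - h * mu / 2) * enorm (x - xstar) ^+ 2
     + h * (gamma ^+ 2 * (K ^+ 2 * G ^+ 2 / (2 * mu))
            + h ^+ 4 * (2 * K ^+ 4 * G ^+ 2 / mu) + h ^+ 3 * (K ^+ 2 * G ^+ 2)).
Proof.
move=> mu0 h_small Kpos coercive xstar0 gxG gG1 gG2.
have h0 : 0 <= h by rewrite mulr_ge0.
set rho := (reversal n * sigma)%g.
have [W1 [-> W1_le E1_le]] := epoch_expansion _ _ gG1.
have [W2 [-> W2_le E2_le]] := epoch_expansion _ _ gG2.
set v := x - xstar; set H := \sum_i A i.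
have sumg : \sum_i gradient (f i) x = H *m v.
  rewrite -[LHS]subr0 -[X in _ - X]xstar0 -sumrB mulmx_suml; apply: eq_bigr => i _.
  by rewrite !gradE mulmxBr opprD addrACA subrr addr0.
rewrite sumg; have [u uD] : {u | u = v - gamma *: (H *m v)}.
  by exists (v - gamma *: (H *m v)).
have uE W : x - gamma *: (H *m v) + W - xstar = u + W.
  by rewrite uD /v addrAC; congr (_ + _); rewrite addrAC.
(* v and u are made opaque, so that dotvE expands only the sums u + W1, u + W2 *)
rewrite !uE; move: v sumg {uE} uD => v sumg uD.
rewrite !sqr_enorm !dotvE.
have hK2 : 4 * (h * K) ^+ 2 <= h * mu.
  move: h_small; rewrite ler_pdivlMr ?mulr_gt0 ?exprn_gt0 // => h_small.
  by rewrite exprMn (_ : 4 * _ = h * (h * (4 * K ^+ 2))) ?ler_wpM2l //; ring.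
have gHv_le : enorm (gamma *: (H *m v)) <= h * K * enorm v.
  rewrite enormZ ger0_norm // (_ : h * K = gamma * (n%:R * K)); last by ring.
  by rewrite -mulrA ler_wpM2l // sum_mulmx_le.
have u_le : dotv u u <= (1 - 2 * (h * mu) + (h * K) ^+ 2) * dotv v v.
  have := coercive v; rewrite -/H => co.
  have : gamma * (mu * n%:R * dotv v v) <= gamma * dotv v (H *m v) by rewrite ler_wpM2l.
  have : enorm (gamma *: (H *m v)) ^+ 2 <= (h * K * enorm v) ^+ 2.
    by rewrite ler_pXn2r ?nnegrE ?enorm_ge0 ?mulr_ge0 ?enorm_ge0.
  rewrite exprMn !sqr_enorm uD !dotvE (dotvC (H *m v) v).
  move: (dotv v v) (dotv v (H *m v)) (dotv (H *m v) (H *m v)) => vv vHv HvHv.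
  move=> HvHv_le vHv_ge; rewrite -subr_ge0 (_ : _ - _ =
    2 * (gamma * vHv - gamma * (mu * n%:R * vv))
    + ((h * K) ^+ 2 * vv - gamma * (gamma * HvHv))); last by ring.
  by rewrite addr_ge0 ?mulr_ge0 ?subr_ge0.
have u_le_v : enorm u <= enorm v.
  rewrite -(@ler_pXn2r _ 2) ?nnegrE ?enorm_ge0 // !sqr_enorm (le_trans u_le) //.
  rewrite ler_piMl ?dotvv_ge0 //.
  rewrite -addrA gerDl addrC subr_le0 (le_trans _ (le_trans hK2 _)) //.
    by rewrite ler_peMl ?sqr_ge0 // ler1n.
  by rewrite ler_peMl ?mulr_ge0 ?ler1n // ltW.
have W_sqr (W : 'cV[R]_d) : enorm W <= h ^+ 2 * K * G ->
    dotv W W <= (h ^+ 2 * K * G) ^+ 2.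
  by rewrite -sqr_enorm; exact: sqr_enorm_le.
(* only the sum of the two second-order parts is small, so they stay together *)
have W_split : W1 + W2 = (second_order sigma x + second_order rho x)
    + ((W1 - second_order sigma x) + (W2 - second_order rho x)).
  by rewrite [X in _ = _ + X]addrACA -opprD [RHS]addrC subrK.
have S_le : enorm (second_order sigma x + second_order rho x)
    <= (h * K) ^+ 2 * enorm v + gamma * h * K * G.
  rewrite second_order_reversal sumg -/H scalerBr.
  rewrite (le_trans (enormD _ _)) // enormN lerD //.
    rewrite enormZ ger0_norm ?exprn_ge0 //.
    rewrite (_ : (h * K) ^+ 2 * _ = gamma ^+ 2 * (n%:R * K * (n%:R * K * enorm v))).
      rewrite ler_wpM2l ?exprn_ge0 // (le_trans (sum_mulmx_le _)) //.
      by rewrite ler_wpM2l ?mulr_ge0 // sum_mulmx_le.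
    by ring.
  rewrite enormZ ger0_norm ?exprn_ge0 //.
  rewrite (_ : gamma * h * K * G = gamma ^+ 2 * (n%:R * (K * G))); last by ring.
  rewrite ler_wpM2l ?exprn_ge0 // enorm_sum_le ?mulr_ge0 // => i.
  by rewrite (le_trans (A_le _ _)) ?ler_wpM2l.
have cross : dotv u W1 + dotv u W2 <= enorm v *
    ((h * K) ^+ 2 * enorm v + gamma * h * K * G + 2 * (h ^+ 3 * K ^+ 2 * G)).
  rewrite -dotvDr W_split (le_trans (cauchy_schwarz _ _)) //.
  rewrite ler_pM ?enorm_ge0 // (le_trans (enormD _ _)) // lerD //.
  apply: (le_trans (enormD _ _)); rewrite mulr_natl mulr2n.
  exact: lerD E1_le E2_le.
have := W_sqr _ W1_le; have := W_sqr _ W2_le; move: u_le cross.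
rewrite (dotvC W1) (dotvC W2) -!sqr_enorm.
move=> u_le cross w2_le w1_le.
exact: (@pair_energy_bound R _ _ _ _ _ _ _ _ _ _ _ mu0 h0 hK2 u_le cross w1_le w2_le).
Qed.

End EpochExpansion.

(** * Expectation over the permutations *)

Section Expectation.
Context {R : realType} {Omega : finType}.
Implicit Types (X Y : Omega -> R).

Lemma unif_expectation_le X (c : R) : (0 < #|Omega|)%N ->
  (forall w, X w <= c) -> unif_expectation X <= c.
Proof.
move=> Omega0 Xc; rewrite ler_pdivrMr ?ltr0n // mulr_natr -sumr_const.
exact: ler_sum.
Qed.

(** A bound on X averaged over w and p w suffices, because X and its composite
    with the bijection p have the same expectation. *)
Lemma unif_expectation_paired (p : Omega -> Omega) X Y (a c : R) :
  (0 < #|Omega|)%N -> injective p ->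
  (forall w, (X w + X (p w)) / 2 <= a * Y w + c) ->
  unif_expectation X <= a * unif_expectation Y + c.
Proof.
move=> Omega0 p_inj pairXY.
have N0 : 0 < #|Omega|%:R :> R by rewrite ltr0n.
rewrite /unif_expectation mulrA ler_pdivrMr // mulrDl divfK ?gt_eqF //.
have -> : \sum_w X w = \sum_w (X w + X (p w)) / 2.
  rewrite -mulr_suml big_split /=.
  have -> : \sum_w X (p w) = \sum_w X w by rewrite [RHS](reindex_inj p_inj).
  by move: (\sum_w X w) => S; field.
rewrite mulr_natr -sumr_const mulr_sumr -big_split /=.
exact: ler_sum.
Qed.

End Expectation.

Lemma card_schedules_gt0 l n : (0 < #|{ffun 'I_l -> 'S_n}|)%N.
Proof. by apply/card_gt0P; exists [ffun=> 1%g]. Qed.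

Section Epochs.
Context {R : realType} {d n l : nat}.
Variables (f : 'I_n -> 'cV[R]_d -> R) (gamma : R) (x0 : 'cV[R]_d).
Implicit Types (s : {ffun 'I_l -> 'S_n}).

Lemma after_epochsS s (t : 'I_l) :
  after_epochs f gamma s x0 t.+1 =
  epoch f gamma (s t) (after_epochs f gamma s x0 t) n.
Proof.
rewrite /after_epochs (take_nth t) ?size_enum_ord // foldl_rcons.
by rewrite (_ : nth t _ t = t) // nth_ord_enum.
Qed.

(** The point reached after t epochs depends only on the permutations of these
    epochs, so it is not affected when that of the next epoch is reversed. *)
Lemma eq_after_epochs s s' t : (t <= l)%N ->
  (forall j : 'I_l, (j < t)%N -> s j = s' j) ->
  after_epochs f gamma s x0 t = after_epochs f gamma s' x0 t.
Proof.
elim: t => [|t IH] tl ss'; first by rewrite /after_epochs !take0.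
rewrite (after_epochsS s (Ordinal tl)) (after_epochsS s' (Ordinal tl)) /=.
rewrite IH ?(ltnW tl) ?ss' // => j jt.
by apply: ss'; exact: ltnW.
Qed.

Definition reverse_epoch (t : 'I_l) s : {ffun 'I_l -> 'S_n} :=
  [ffun j => if j == t then (reversal n * s j)%g else s j].

Lemma reverse_epoch_inj t : injective (reverse_epoch t).
Proof.
move=> s s' /ffunP eqs; apply/ffunP => j; have := eqs j.
by rewrite !ffunE; case: eqP => // _; exact: mulgI.
Qed.

Lemma after_reverse_epoch t s :
  after_epochs f gamma (reverse_epoch t s) x0 t = after_epochs f gamma s x0 t.
Proof.
apply: eq_after_epochs => [|j jt]; first exact: ltnW.
by rewrite ffunE -val_eqE ltn_eqF.
Qed.

End Epochs.

(** * The recursion over the epochs *)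

(** B is the fixed point of the recursion. *)
Lemma geometric_recursion {R : realFieldType} (l : nat) (a : nat -> R) (rho B D2 : R) :
  0 <= rho <= 1 -> 0 <= B -> a 0%N <= D2 ->
  (forall t, (t < l)%N -> a t.+1 <= (1 - rho) * a t + rho * B) ->
  a l <= (1 - rho) ^+ l * D2 + B.
Proof.
move=> /andP[rho0 rho1] B0 a0 rec.
suff : forall t, (t <= l)%N -> a t <= (1 - rho) ^+ t * D2 + B by apply.
elim=> [_|t IH tl]; first by rewrite expr0 mul1r (le_trans a0) ?lerDl.
apply: (le_trans (rec t tl)).
have -> : (1 - rho) ^+ t.+1 * D2 + B
    = (1 - rho) * ((1 - rho) ^+ t * D2 + B) + rho * B by rewrite exprS; ring.
by rewrite lerD2r ler_wpM2l ?subr_ge0 // IH // ltnW.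
Qed.

Lemma small_step_le1 {R : realFieldType} {mu K h : R} : 0 < mu -> 0 < K -> mu <= K ->
  0 <= h -> h <= mu / (4 * K ^+ 2) -> h * mu / 2 <= 1.
Proof.
move=> mu0 K0 muK h0; rewrite ler_pdivlMr ?mulr_gt0 ?exprn_gt0 // => h_small.
rewrite ler_pdivrMr // mul1r -(ler_pM2r (exprn_gt0 2 K0)).
have muhK : mu * (h * (4 * K ^+ 2)) <= K * K.
  rewrite ler_pM ?(ltW mu0) ?(le_trans h_small) //.
  by rewrite !mulr_ge0 // ?exprn_ge0 // ltW.
rewrite (_ : h * mu * K ^+ 2 = 4^-1 * (mu * (h * (4 * K ^+ 2)))); last by field.
rewrite (le_trans (ler_wpM2l _ muhK)) ?invr_ge0 // -expr2.
by rewrite ler_wpM2r ?sqr_ge0 // (@le_trans _ _ 1) ?invf_le1 ?ler1n.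
Qed.

(** The fixed point of the recursion is the error made in one epoch divided by
    h mu / 2; the factor h of that error cancels, which leaves gamma^2 and h^3. *)
Lemma expected_distance_le (R : realType) (mu K D G gamma : R) (d n l : nat)
    (A : 'I_n -> 'M[R]_d) (b : 'I_n -> 'cV[R]_d) (xstar x0 : 'cV[R]_d)
    (f := fun i : 'I_n => quadratic (A i) (b i)) (h := gamma * n%:R) :
  0 < mu -> 0 < K -> 0 <= G -> 0 <= gamma -> mu <= K -> (0 < l)%N ->
  h <= mu / (4 * K ^+ 2) ->
  (forall i, (A i)^T = A i) ->
  (forall i x, enorm (A i *m x) <= K * enorm x) ->
  (forall y, mu * n%:R * dotv y y <= dotv y ((\sum_i A i) *m y)) ->
  \sum_i gradient (f i) xstar = 0 ->
  (forall (s : {ffun 'I_l -> 'S_n}) (t : 'I_l) (k : nat), (k <= n)%N ->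
     enorm (iterate f gamma s x0 t k - xstar) <= D) ->
  (forall (i : 'I_n) (x : 'cV[R]_d),
     enorm (x - xstar) <= D -> enorm (gradient (f i) x) <= G) ->
  unif_expectation (fun s : {ffun 'I_l -> 'S_n} =>
     enorm (output f gamma s x0 - xstar) ^+ 2)
  <= (1 - h * mu / 2) ^+ l * D ^+ 2
     + 2 / mu * (gamma ^+ 2 * (K ^+ 2 * G ^+ 2 / (2 * mu))
         + h ^+ 4 * (2 * K ^+ 4 * G ^+ 2 / mu) + h ^+ 3 * (K ^+ 2 * G ^+ 2)).
Proof.
move=> mu0 K0 G0 gamma0 muK l0 h_small As A_le coercive xstar0 iterD gradG.
have h0 : 0 <= h by rewrite mulr_ge0.
set c := (X in 2 / mu * X).
have c0 : 0 <= c.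
  by rewrite !addr_ge0 // !(mulr_ge0, exprn_ge0, invr_ge0) // ltW.
have Omega0 := card_schedules_gt0 l n.
pose a t := unif_expectation (fun s : {ffun 'I_l -> 'S_n} =>
  enorm (after_epochs f gamma s x0 t - xstar) ^+ 2).
apply: (@geometric_recursion R l a (h * mu / 2)).
- rewrite !mulr_ge0 ?invr_ge0 ?(ltW mu0) //=.
  exact: small_step_le1 mu0 K0 muK h0 h_small.
- by rewrite mulr_ge0 // divr_ge0 // ltW.
- apply: unif_expectation_le => // s; apply: sqr_enorm_le.
  by have := iterD s (Ordinal l0) 0%N isT; rewrite /iterate epoch0.
- move=> t tl; pose t' := Ordinal tl.
  have -> : h * mu / 2 * (2 / mu * c) = h * c.
    by field; rewrite gt_eqF.
  apply: (unif_expectation_paired (reverse_epoch t')) => //.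
    exact: reverse_epoch_inj.
  move=> s; rewrite (after_epochsS f gamma x0 s t').
  rewrite (after_epochsS f gamma x0 (reverse_epoch t' s) t') after_reverse_epoch.
  rewrite [reverse_epoch t' s t']ffunE eqxx.
  have grad_iter (s' : {ffun 'I_l -> 'S_n}) k i : (k <= n)%N ->
      after_epochs f gamma s' x0 t = after_epochs f gamma s x0 t ->
      enorm (gradient (f i)
        (epoch f gamma (s' t') (after_epochs f gamma s x0 t) k)) <= G.
    by move=> kn eqx; apply: gradG; rewrite -eqx; exact: iterD.
  apply: (@epoch_pair_contraction R d n f A b gamma K G) => //.
  + by move=> i x; exact: gradient_quadratic.
  + exact: ltW.
  + by move=> i; have := grad_iter s 0%N i isT erefl; rewrite epoch0.
  + by move=> k; apply: grad_iter => //; exact: ltnW.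
  + move=> k; have := grad_iter (reverse_epoch t' s) k
      ((reversal n * s t')%g k) (ltnW (ltn_ord k))
      (after_reverse_epoch f gamma x0 t' s).
    by rewrite ffunE eqxx.
Qed.

(** * The convergence rate *)

Theorem theorem1 (R : realType) (mu L D G : R) :
  0 < mu -> 0 < D -> 0 < G ->
  exists C0 q : R, 0 < C0 /\ 0 < q /\
  forall (d n l T : nat) (A : 'I_n -> 'M[R]_d) (b : 'I_n -> 'cV[R]_d)
         (xstar x0 : 'cV[R]_d),
    let f := fun i : 'I_n => quadratic (A i) (b i) in
    let F := average f in
    let kappa := L / mu in
    let gamma := 4 * ln (T%:R : R) / (T%:R * mu) in
    (forall i, (A i)^T = A i) ->
    (forall i, psd (A i)) ->
    (forall i, L_smooth L (f i)) ->
    strongly_convex mu F ->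
    is_unique_minimizer F xstar ->
    (2 <= T)%N ->
    T = (l * n)%N ->
    T%:R / ln (T%:R : R) > 6 * (1 + kappa) * n%:R ->
    (forall (s : {ffun 'I_l -> 'S_n}) (t : 'I_l) (k : nat), (k <= n)%N ->
       enorm (iterate f gamma s x0 t k - xstar) <= D) ->
    (forall (i : 'I_n) (x : 'cV[R]_d),
       enorm (x - xstar) <= D -> enorm (gradient (f i) x) <= G) ->
    unif_expectation (fun s : {ffun 'I_l -> 'S_n} =>
       enorm (output f gamma s x0 - xstar) ^+ 2)
    <= C0 * (1 + ln (T%:R : R)) `^ q
       * (1 / T%:R ^+ 2 + n%:R ^+ 3 / T%:R ^+ 3).
Proof.
move=> mu0 D0 G0.
(* unlike L, this Lipschitz constant is positive also in dimension 0 *)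
pose K := `|L| + mu.
have K0 : 0 < K by rewrite ltr_wpDl.
have muK : mu <= K by rewrite lerDr.
have LK : L <= K by rewrite (le_trans (ler_norm L)) // lerDl ltW.
(* h <= eps turns (h K)^2 into at most a quarter of h mu *)
pose eps := mu / (4 * K ^+ 2).
have eps0 : 0 < eps by rewrite divr_gt0 ?mulr_gt0 ?exprn_gt0.
(* c1 and c2 come from the terms gamma^2 and h^4, h^3; c3 serves when h > eps *)
pose c1 := 2 / mu * ((4 / mu) ^+ 2 * (K ^+ 2 * G ^+ 2 / (2 * mu))).
pose c2 := 2 / mu * ((4 / mu) ^+ 3
  * (eps * (2 * K ^+ 4 * G ^+ 2 / mu) + K ^+ 2 * G ^+ 2)).
pose c3 := (4 / (mu * eps)) ^+ 3 * D ^+ 2.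
have c1_ge0 : 0 <= c1.
  by rewrite /c1 !(mulr_ge0, exprn_ge0, invr_ge0) // ltW.
have c2_ge0 : 0 <= c2.
  by rewrite /c2 !(addr_ge0, mulr_ge0, exprn_ge0, invr_ge0) // ltW.
have c3_ge0 : 0 <= c3.
  by rewrite /c3 !(mulr_ge0, exprn_ge0, invr_ge0) // ltW.
exists (D ^+ 2 + c1 + c2 + c3), 3; split.
  by rewrite -!addrA ltr_wpDr ?exprn_gt0 // !addr_ge0.
split=> // d n l T A b xstar x0 f F kappa gamma As _ f_smooth F_cvx [F_min _].
move=> T2 T_eq _ iterD gradG.
have [n0 l0] : (0 < n)%N /\ (0 < l)%N.
  by apply/andP; rewrite -muln_gt0 mulnC -T_eq ltnW.
have nR : 0 < n%:R :> R by rewrite ltr0n.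
have TR : 0 < T%:R :> R by rewrite ltr0n (leq_trans _ T2).
have lnT0 : 0 <= ln (T%:R : R) by rewrite ln_ge0 // ler1n (leq_trans _ T2).
set lam := 1 + ln (T%:R : R); have lam1 : 1 <= lam by rewrite lerDl.
have lam0 : 0 <= lam by exact: le_trans lam1.
have gamma0 : 0 <= gamma by rewrite /gamma !(mulr_ge0, invr_ge0) // ltW.
have gamma_le : gamma <= 4 / mu * (lam / T%:R).
  rewrite (_ : gamma = 4 / mu * (ln (T%:R : R) / T%:R)); last first.
    by rewrite /gamma; field; rewrite !gt_eqF.
  rewrite ler_wpM2l ?divr_ge0 ?(ltW mu0) // ler_wpM2r ?invr_ge0 ?(ltW TR) //.
  by rewrite lerDr.
set h := gamma * n%:R.
have h0 : 0 <= h by rewrite mulr_ge0.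
have h_le : h <= 4 / mu * (lam * (n%:R / T%:R)).
  by rewrite (_ : _ * (lam * _) = 4 / mu * (lam / T%:R) * n%:R) ?ler_wpM2r //; ring.
rewrite powR_mulrn //.
set r2 := 1 / T%:R ^+ 2; set r3 := n%:R ^+ 3 / T%:R ^+ 3.
have r2_ge0 : 0 <= r2 by rewrite divr_ge0 ?exprn_ge0 // ltW.
have r3_ge0 : 0 <= r3 by rewrite divr_ge0 ?exprn_ge0 // ltW.
have h3_le : h ^+ 3 <= (4 / mu) ^+ 3 * (lam ^+ 3 * r3).
  rewrite (_ : _ * _ = (4 / mu * (lam * (n%:R / T%:R))) ^+ 3).
    by rewrite ler_pXn2r ?nnegrE // (le_trans h0).
  by rewrite /r3 -expr_div_n -!exprMn.
have lam3 : 1 <= lam ^+ 3 by rewrite exprn_ege1.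
have Omega0 := card_schedules_gt0 l n.
have [h_small|h_large] := leP h eps; last first.
  apply: (@le_trans _ _ (D ^+ 2)).
    apply: unif_expectation_le => // s; apply: sqr_enorm_le.
    have l1 : (l.-1 < l)%N by rewrite prednK.
    have := iterD s (Ordinal l1) n (leqnn n).
    by rewrite /iterate -after_epochsS /= prednK.
  have c3_le : D ^+ 2 <= c3 * (lam ^+ 3 * r3).
    have h_eps : 1 <= (h / eps) ^+ 3.
      by rewrite exprn_ege1 // ler_pdivlMr // mul1r ltW.
    rewrite (_ : c3 * _ = D ^+ 2 * ((4 / mu) ^+ 3 * (lam ^+ 3 * r3) / eps ^+ 3)).
      rewrite ler_peMr ?exprn_ge0 ?(ltW D0) // (le_trans h_eps) // expr_div_n.
      by rewrite ler_wpM2r ?invr_ge0 ?exprn_ge0 // ltW.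
    by rewrite /c3; field; rewrite !gt_eqF.
  apply: (le_trans c3_le); rewrite -mulrA; apply: ler_pM => //.
  - by rewrite mulr_ge0 // exprn_ge0.
  - by rewrite lerDr !addr_ge0 ?exprn_ge0 // ltW.
  - by rewrite ler_wpM2l ?exprn_ge0 // lerDr.
have A_le i x : enorm (A i *m x) <= K * enorm x.
  apply: (le_trans (L_smooth_mulmx_le _ _ _ _ (As i) (f_smooth i))).
  by rewrite ler_wpM2r ?enorm_ge0.
rewrite /F average_quadratic in F_cvx F_min.
set H := _ *: \sum_i A i in F_cvx F_min.
have Hs : H^T = H.
  by rewrite linearZ linear_sum /=; congr (_ *: _); apply: eq_bigr => i _.
have H_coercive y := strongly_convex_quadratic _ _ _ y Hs F_cvx.
have coercive y : mu * n%:R * dotv y y <= dotv y ((\sum_i A i) *m y).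
  have := H_coercive y; rewrite -scalemxAl dotvZr ler_pdivlMl //.
  by rewrite mulrA (mulrC n%:R).
have Hpsd : psd H.
  by move=> y; apply: le_trans (H_coercive y); rewrite mulr_ge0 ?dotvv_ge0 ?ltW.
have xstar0 : \sum_i gradient (f i) xstar = 0.
  have := minimizer_quadratic _ _ _ Hs Hpsd F_min.
  rewrite -scalemxAl -scalerDr => /eqP; rewrite scaler_eq0 invr_eq0 gt_eqF //=.
  move=> /eqP gsum; rewrite -[RHS]gsum mulmx_suml -big_split.
  by apply: eq_bigr => i _; exact: gradient_quadratic.
apply: (le_trans (expected_distance_le R mu K D G gamma d n l A b xstar x0 mu0 K0
  (ltW G0) gamma0 muK l0 h_small As A_le coercive xstar0 iterD gradG)).
rewrite -/h !mulrDr.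
(* h * l = gamma * T, so the exponent is - 2 ln T *)
have bias_le : (1 - h * mu / 2) ^+ l <= r2.
  apply: (@le_trans _ _ (expR (- (h * mu / 2)) ^+ l)).
    rewrite ler_pXn2r ?nnegrE ?expR_ge0 //; first exact: expR_ge1Dx.
    by rewrite subr_ge0 (small_step_le1 mu0 K0).
  rewrite -expRM_natl mulrN (_ : l%:R * _ = 2%:R * ln (T%:R : R)).
    by rewrite expRN expRM_natl lnK // /r2 div1r.
  rewrite /h /gamma T_eq natrM; field.
  by rewrite !gt_eqF // ltr0n.
have gamma_term : 2 / mu * (gamma ^+ 2 * (K ^+ 2 * G ^+ 2 / (2 * mu)))
    <= c1 * (lam ^+ 3 * r2).
  rewrite (_ : c1 * _ = 2 / mu * ((4 / mu) ^+ 2 * (lam ^+ 3 * r2)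
    * (K ^+ 2 * G ^+ 2 / (2 * mu)))); last by rewrite /c1; ring.
  rewrite ler_wpM2l ?divr_ge0 ?(ltW mu0) // ler_wpM2r //.
    by rewrite !(mulr_ge0, exprn_ge0, invr_ge0) // ltW.
  apply: (@le_trans _ _ ((4 / mu * (lam / T%:R)) ^+ 2)).
    by rewrite ler_pXn2r ?nnegrE // (le_trans gamma0).
  rewrite exprMn (expr_div_n lam) ler_wpM2l ?sqr_ge0 // /r2 div1r.
  by rewrite ler_wpM2r ?invr_ge0 ?exprn_ge0 ?(ltW TR) // ler_weXn2l.
have h3_term : 2 / mu * (h ^+ 3 * (K ^+ 2 * G ^+ 2))
    <= 2 / mu * ((4 / mu) ^+ 3 * (K ^+ 2 * G ^+ 2)) * (lam ^+ 3 * r3).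
  rewrite (_ : _ * (lam ^+ 3 * r3) = 2 / mu * ((4 / mu) ^+ 3 * (lam ^+ 3 * r3)
    * (K ^+ 2 * G ^+ 2))); last by ring.
  rewrite ler_wpM2l ?divr_ge0 ?(ltW mu0) // ler_wpM2r //.
  by rewrite mulr_ge0 ?exprn_ge0 // ltW.
(* one factor h is bounded by eps *)
have h4_term : 2 / mu * (h ^+ 4 * (2 * K ^+ 4 * G ^+ 2 / mu))
    <= 2 / mu * ((4 / mu) ^+ 3 * (eps * (2 * K ^+ 4 * G ^+ 2 / mu))) * (lam ^+ 3 * r3).
  rewrite (_ : _ * (lam ^+ 3 * r3) = 2 / mu * ((eps * ((4 / mu) ^+ 3 * (lam ^+ 3 * r3)))
    * (2 * K ^+ 4 * G ^+ 2 / mu))); last by ring.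
  rewrite ler_wpM2l ?divr_ge0 ?(ltW mu0) // exprS.
  apply: ler_wpM2r; last by rewrite ler_pM ?exprn_ge0.
  by rewrite !(mulr_ge0, exprn_ge0, invr_ge0) // ltW.
have D_term : (1 - h * mu / 2) ^+ l * D ^+ 2 <= D ^+ 2 * (lam ^+ 3 * r2).
  rewrite mulrC ler_wpM2l ?sqr_ge0 // (le_trans bias_le) //.
  by rewrite ler_peMl.
apply: (le_trans (lerD D_term (lerD (lerD gamma_term h4_term) h3_term))).
rewrite -subr_ge0 (_ : _ - _ = c3 * (lam ^+ 3 * (r2 + r3)) + c2 * (lam ^+ 3 * r2)
  + (D ^+ 2 + c1) * (lam ^+ 3 * r3)); last by rewrite /c2; ring.
have term_ge0 (u v : R) : 0 <= u -> 0 <= v -> 0 <= u * (lam ^+ 3 * v).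
  by move=> u0 v0; rewrite !mulr_ge0 ?exprn_ge0.
exact: addr_ge0 (addr_ge0 (term_ge0 _ _ c3_ge0 (addr_ge0 r2_ge0 r3_ge0))
  (term_ge0 _ _ c2_ge0 r2_ge0))
  (term_ge0 _ _ (addr_ge0 (sqr_ge0 D) c1_ge0) r3_ge0).
Qed.
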